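(* The triple $(\mathfrak S_1(\mathbb R),\mathfrak S_1(\mathbb T),p)$ has the path lifting property: if $\tilde S_0\in\mathfrak S_1(\mathbb R)$, $S\colon[0,1]\to\mathfrak S_1(\mathbb T)$ is continuous and $p(\tilde S_0)=S(0)$, then there exists a continuous path $\tilde S\colon[0,1]\to\mathfrak S_1(\mathbb R)$ with $\tilde S(0)=\tilde S_0$ and $S=p\circ\tilde S$.
   Context: A rigged subset $S$ of a set $X$ assigns to each $x\in X$ a multiplicity $\mathrm{mult}(x;S)\in\{0,1,2,\dots,\infty\}$; an enumeration is a sequence in which each $x$ appears $\mathrm{mult}(x;S)$ times. For a metric space $X$ with base point $x_0$, $\mathfrak S_\infty(X)$ consists of countable rigged subsets in which $x_0$ has multiplicity $\infty$ and with no accumulation point (a point every neighbourhood of which contains infinitely many elements counting multiplicity) other than $x_0$; $d(S,T)=\inf\sum_j\mathrm{dist}(s_j,t_j)$ over enumerations $(s_j),(t_j)$ of $S,T$; $\mathfrak S_1(X)=\{S:d(S,\mathbf x_0)<\infty\}$ where $\mathbf x_0$ is $x_0$ with infinite multiplicity. $\mathfrak S_1(\mathbb R)$ uses base point $0$, $\mathfrak S_1(\mathbb T)$ uses base point $1$ ($\mathbb T$ with arc-length metric). $p\colon\mathfrak S_1(\mathbb R)\to\mathfrak S_1(\mathbb T)$ is the map induced by $\theta\mapsto e^{i\theta}$ (multiplicities of points with the same image are added). *)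

(* Defs.v *)
From Stdlib Require Import Reals Lra List ClassicalEpsilon.
From Coquelicot Require Import Coquelicot.
Import ListNotations.
Open Scope R_scope.

(** Rigged subsets: multiplicity in {0,1,2,...} ∪ {∞}; [None] encodes ∞. *)
Definition rigged (X : Type) := X -> option nat.

Section Rigged.
Variables (X : Type) (dist : X -> X -> R) (x0 : X).

Definition is_enum (S : rigged X) (s : nat -> X) : Prop :=
  forall x, match S x with
            | None => forall N : nat, exists j : nat, (N <= j)%nat /\ s j = x
            | Some n => exists l : list nat,
                length l = n /\ NoDup l /\ (forall j, In j l <-> s j = x)
            end.

Definition rigged_countable (S : rigged X) : Prop :=
  exists f : nat -> X, forall x, S x <> Some 0%nat -> exists n, f n = x.

Definition ball (a : X) (eps : R) : X -> Prop := fun y => dist a y < eps.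

Definition finitely_many_in (S : rigged X) (B : X -> Prop) : Prop :=
  exists l : list X, forall x, B x -> S x <> Some 0%nat -> In x l /\ S x <> None.

Definition accumulation_point (S : rigged X) (a : X) : Prop :=
  forall eps, 0 < eps -> ~ finitely_many_in S (ball a eps).

Definition S_inf (S : rigged X) : Prop :=
  rigged_countable S /\ S x0 = None /\
  (forall a, accumulation_point S a -> a = x0).

Definition enum_cost (s t : nat -> X) : Rbar :=
  Lim_seq (fun n => sum_f_R0 (fun j => dist (s j) (t j)) n).

(** d(S,T) = inf over enumerations, in [0,+oo] (inf of the empty set is +oo) *)
Definition rdist (S T : rigged X) : Rbar :=
  Glb_Rbar (fun r : R => exists s t, is_enum S s /\ is_enum T t /\
                                     enum_cost s t = Finite r).

Definition bold_base : rigged X :=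
  fun x => if excluded_middle_informative (x = x0) then None else Some 0%nat.

Definition S_one (S : rigged X) : Prop :=
  S_inf S /\ Rbar_lt (rdist S bold_base) p_infty.

Definition cont_path (P : R -> rigged X) : Prop :=
  (forall t, 0 <= t <= 1 -> S_one (P t)) /\
  (forall t, 0 <= t <= 1 -> forall eps, 0 < eps -> exists delta, 0 < delta /\
     forall t', 0 <= t' <= 1 -> Rabs (t' - t) < delta ->
       Rbar_lt (rdist (P t') (P t)) (Finite eps)).
End Rigged.

Definition distR (a b : R) : R := Rabs (a - b).

(** The unit circle T ⊂ R^2 with arc-length metric, base point 1 = (1,0). *)
Definition Tcirc := { z : R * R | fst z ^ 2 + snd z ^ 2 = 1 }.

Definition distT (z w : Tcirc) : R :=
  acos (fst (proj1_sig z) * fst (proj1_sig w) + snd (proj1_sig z) * snd (proj1_sig w)).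

Lemma one_in_T : fst (1, 0) ^ 2 + snd (1, 0) ^ 2 = 1.
Proof. simpl. lra. Qed.

Definition T_one : Tcirc := exist _ (1, 0) one_in_T.

Definition mult_val (m : option nat) : nat :=
  match m with Some n => n | None => 0%nat end.

(** [pushforward S S'] : S' = p(S), where p is induced by θ ↦ e^{iθ} = (cos θ, sin θ):
    mult(z; S') = sum of mult(θ; S) over θ with e^{iθ} = z (∞ if that sum is infinite). *)
Definition pushforward (S : rigged R) (S' : rigged Tcirc) : Prop :=
  forall z : Tcirc,
    let A := fun th : R => proj1_sig z = (cos th, sin th) in
    match S' z with
    | Some n => exists l : list R,
        NoDup l /\ (forall th, In th l <-> (A th /\ S th <> Some 0%nat)) /\
        (forall th, In th l -> S th <> None) /\
        fold_right (fun th acc => (mult_val (S th) + acc)%nat) 0%nat l = n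
    | None => ~ exists l : list R,
        forall th, A th -> S th <> Some 0%nat -> In th l /\ S th <> None
    end.

(* Main.v *)
(** A path in S_1(T) is lifted first locally in time.  Near a time t0 the rigged sets P(t) all stay away from some point e^{i alpha}, so cutting the circle there turns them into summable families in an interval of R around 0.  Sorting the positive and the negative members separately enumerates P(t) by functions w_m(t); each is 1-Lipschitz in P(t), and so is the total sum of |w_m(t)|, hence t |-> w(t) is continuous in l^1 by Scheffe's lemma.  An enumeration r of the initial lift can be matched with w(a) modulo 2 pi, and r_m + w_m(t) - w_m(a) enumerates the lift at time t.  A supremum argument on [0,1] then glues local lifts. *)

Require Import Defs.
From Stdlib Require Import Reals Lra Lia ZArith List FinFun ClassicalEpsilon FunctionalExtensionality.
From Coquelicot Require Import Coquelicot.
Import ListNotations.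
Open Scope R_scope.

(** The map p is not a covering and lifts are not unique: when a point leaves 1, any member of the
    lift over 1 may be the one that moves. The metric only offers some matching for each pair of
    nearby times, and these matchings do not fit together into trajectories of single members.
    Sorting replaces them by a choice that depends on the rigged set alone. It needs a linear order,
    hence the cut; since 0 is interior to the cut interval and members tend to it from both sides,
    there are two sorted lists. A member crossing the cut would leave one list for the other and
    shift all ranks, so one cut serves only a short time interval. Comparing ranks bounds each
    coordinate separately, which is a sup-norm estimate, while the distance is of type l^1;
    continuity of the total sum supplies the control of the tails. The given lift need not lie in
    the cut interval: its members differ from those of w(a) by multiples of 2 pi, also over the base
    point. Each keeps the offset r_m - w_m(a) while it moves. *)

Lemma fun_choice (A B : Type) (R : A -> B -> Prop) :
  (forall a, exists b, R a b) -> exists f, forall a, R a (f a).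
Proof.
  intros H.
  exists (fun a => proj1_sig (constructive_indefinite_description _ (H a))).
  intros a. apply proj2_sig.
Qed.

(** * Finite and infinite sets of indices *)

Definition unbounded (A : nat -> Prop) := forall N : nat, exists j : nat, (N <= j)%nat /\ A j.

Lemma not_unbounded (A : nat -> Prop) :
  ~ unbounded A -> exists N : nat, forall j, A j -> (j < N)%nat.
Proof.
  intros H. apply not_all_ex_not in H. destruct H as [N H].
  exists N. intros j Hj. destruct (Nat.lt_ge_cases j N) as [|Hle]; auto.
  exfalso. apply H. now exists j.
Qed.

Lemma bounded_list (A : nat -> Prop) (N : nat) :
  (forall j, A j -> (j < N)%nat) ->
  exists l, NoDup l /\ forall j, In j l <-> A j.
Proof.
  intros H.
  exists (filter (fun j => if excluded_middle_informative (A j) then true else false) (seq 0 N)).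
  split.
  - apply NoDup_filter, seq_NoDup.
  - intros j. rewrite filter_In, in_seq.
    destruct (excluded_middle_informative (A j)) as [a|a]; split; try tauto.
    + intros _. split; auto. specialize (H j a). lia.
    + intros [_ E]. discriminate.
Qed.

Lemma unbounded_inj (A : nat -> Prop) :
  unbounded A -> exists g, Injective g /\ forall i : nat, A (g i).
Proof.
  intros H. destruct (fun_choice _ _ _ H) as [h Hh].
  set (g := fix g n := match n with O => h O | S m => h (S (g m)) end).
  assert (Hlt : forall k i, (g i < g (i + S k))%nat).
  { induction k as [|k IH]; intros i.
    - rewrite Nat.add_1_r. simpl. destruct (Hh (S (g i))). lia.
    - specialize (IH i). rewrite <- !plus_n_Sm in *. simpl in *.
      destruct (Hh (S (h (S (g (i + k)%nat))))). lia. }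
  exists g. split.
  - intros i i' E. destruct (Nat.lt_trichotomy i i') as [L|[|L]]; auto; exfalso.
    + specialize (Hlt (i' - S i)%nat i). replace (i + S (i' - S i))%nat with i' in Hlt by lia. lia.
    + specialize (Hlt (i - S i')%nat i'). replace (i' + S (i - S i'))%nat with i in Hlt by lia. lia.
  - intros [|i]; simpl; apply Hh.
Qed.

Lemma unbounded_of_lists (A : nat -> Prop) :
  (forall n, exists l, NoDup l /\ length l = n /\ forall i, In i l -> A i) -> unbounded A.
Proof.
  intros H. apply NNPP. intros C. destruct (not_unbounded _ C) as [N HN].
  destruct (H (S N)) as (l & ND & L & Hl).
  assert (length l <= length (seq 0 N))%nat.
  { apply NoDup_incl_length; auto. intros i Hi. apply in_seq. specialize (HN i (Hl i Hi)). lia. }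
  rewrite length_seq in *. lia.
Qed.

Lemma unbounded_lists (A : nat -> Prop) (n : nat) :
  unbounded A -> exists l, NoDup l /\ length l = n /\ forall i, In i l -> A i.
Proof.
  intros H. destruct (unbounded_inj _ H) as [g [Ig Hg]].
  exists (map g (seq 0 n)). split; [|split].
  - apply Injective_map_NoDup; auto. apply seq_NoDup.
  - now rewrite length_map, length_seq.
  - intros i Hi. apply in_map_iff in Hi. destruct Hi as [k [<- _]]. apply Hg.
Qed.

Lemma list_injection (k l : list nat) :
  NoDup l -> (length k <= length l)%nat ->
  exists g, (forall i, In i k -> In (g i) l) /\
    forall i j, In i k -> In j k -> g i = g j -> i = j.
Proof.
  revert l. induction k as [|a k IH]; intros l ND L.
  - exists (fun i => i). split; intros i []; contradiction.
  - destruct l as [|b l]; simpl in L; [lia|]. inversion_clear ND as [|? ? Hb ND'].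
    destruct (IH l ND') as [g [G1 G2]]; [lia|].
    exists (fun i => if Nat.eq_dec i a then b else g i). split.
    + intros i [<-|Hi].
      * destruct (Nat.eq_dec a a); simpl; auto; congruence.
      * destruct (Nat.eq_dec i a); simpl; auto.
    + intros i j Hi Hj.
      assert (Hk : forall i, In i (a :: k) -> i <> a -> In i k).
      { intros x [->|]; auto; congruence. }
      destruct (Nat.eq_dec i a) as [->|Ni], (Nat.eq_dec j a) as [->|Nj]; auto; intros E.
      * exfalso. apply Hb. rewrite E. auto.
      * exfalso. apply Hb. rewrite <- E. auto.
Qed.

(** * Sums of nonnegative families over finite sets of indices *)

Definition lsum (a : nat -> R) (l : list nat) : R := fold_right (fun i acc => a i + acc) 0 l.

(** For nonnegative [a] this says that the series converges with sum at most [M]. Quantifying over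
    finite duplicate-free lists makes it insensitive to the order of summation, so reindexing along
    an injection is immediate. *)
Definition sum_le (a : nat -> R) (M : R) := forall l, NoDup l -> lsum a l <= M.

Lemma lsum_le (a b : nat -> R) (l : list nat) :
  (forall i, In i l -> a i <= b i) -> lsum a l <= lsum b l.
Proof.
  induction l as [|i l IH]; intros H; simpl; [lra|].
  pose proof (H i (or_introl eq_refl)). specialize (IH (fun j Hj => H j (or_intror Hj))). lra.
Qed.

Lemma lsum_nonneg (a : nat -> R) (l : list nat) : (forall i, 0 <= a i) -> 0 <= lsum a l.
Proof. intros H. induction l as [|i l IH]; simpl; [lra|]. specialize (H i). lra. Qed.

Lemma lsum_plus (a b : nat -> R) (l : list nat) :
  lsum (fun i => a i + b i) l = lsum a l + lsum b l.
Proof. induction l as [|i l IH]; simpl; lra. Qed.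

Lemma lsum_const (c : R) (l : list nat) : lsum (fun _ => c) l = INR (length l) * c.
Proof.
  induction l as [|i l IH]; [simpl; lra|].
  change (length (i :: l)) with (S (length l)). rewrite S_INR. simpl. lra.
Qed.

Lemma lsum_app (a : nat -> R) (k l : list nat) : lsum a (k ++ l) = lsum a k + lsum a l.
Proof. induction k as [|i k IH]; simpl; lra. Qed.

Lemma lsum_map (a : nat -> R) (f : nat -> nat) (l : list nat) :
  lsum a (map f l) = lsum (fun i => a (f i)) l.
Proof. induction l as [|i l IH]; simpl; lra. Qed.

Lemma lsum_filter (a : nat -> R) (b : nat -> bool) (l : list nat) :
  lsum a l = lsum a (filter b l) + lsum a (filter (fun i => negb (b i)) l).
Proof. induction l as [|i l IH]; simpl; [lra|]. destruct (b i); simpl; lra. Qed.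

Lemma lsum_incl (a : nat -> R) (k l : list nat) :
  (forall i, 0 <= a i) -> NoDup k -> incl k l -> lsum a k <= lsum a l.
Proof.
  intros Ha. revert l. induction k as [|i k IH]; intros l ND I; simpl.
  - now apply lsum_nonneg.
  - inversion_clear ND as [|? ? Hi ND'].
    destruct (in_split i l (I i (or_introl eq_refl))) as (l1 & l2 & ->).
    assert (H : lsum a k <= lsum a (l1 ++ l2)).
    { apply IH; auto. intros j Hj. pose proof (I j (or_intror Hj)) as Hj'.
      apply in_app_or in Hj'. apply in_or_app. destruct Hj' as [|[->|]]; auto. contradiction. }
    rewrite lsum_app in *. simpl. lra.
Qed.

Lemma lsum_seq (a : nat -> R) (n : nat) : lsum a (seq 0 (S n)) = sum_f_R0 a n.
Proof.
  induction n as [|n IH]; [simpl; lra|].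
  rewrite seq_S, lsum_app, IH. simpl. lra.
Qed.

Lemma sum_le_mono (a b : nat -> R) (M : R) :
  (forall i, a i <= b i) -> sum_le b M -> sum_le a M.
Proof. intros H Hb l ND. eapply Rle_trans; [apply lsum_le|apply Hb, ND]. auto. Qed.

Lemma sum_le_plus (a b : nat -> R) (M N : R) :
  sum_le a M -> sum_le b N -> sum_le (fun i => a i + b i) (M + N).
Proof. intros Ha Hb l ND. rewrite lsum_plus. specialize (Ha l ND). specialize (Hb l ND). lra. Qed.

Lemma sum_le_inj (a : nat -> R) (f : nat -> nat) (M : R) :
  Injective f -> sum_le a M -> sum_le (fun i => a (f i)) M.
Proof. intros If H l ND. rewrite <- lsum_map. apply H. now apply Injective_map_NoDup. Qed.

(** A converse to [sum_le_inj]: every positive term comes from some index [i], and chosen preimages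
    of distinct indices are distinct, so a list for [a] turns into a duplicate-free list for the
    composite. *)
Lemma sum_le_pull (a : nat -> R) (c : nat -> nat) (M : R) :
  (forall m, a m <= 0 \/ exists i, c i = m) -> sum_le (fun i => a (c i)) M -> sum_le a M.
Proof.
  intros Hc H l ND.
  assert (exists l', NoDup l' /\ (forall i, In i l' -> In (c i) l) /\
                     lsum a l <= lsum (fun i => a (c i)) l') as (l' & ND' & _ & L).
  { clear H. induction l as [|m l IH].
    - exists []. split; [constructor|]. split; [intros i []|simpl; lra].
    - inversion_clear ND as [|? ? Hm ND'].
      destruct (IH ND') as (l' & N' & I' & L).
      destruct (Hc m) as [Z|[i <-]].
      + exists l'. split; auto. split; [intros i Hi; right; auto|]. simpl. lra.
      + exists (i :: l'). split; [|split].
        * constructor; auto.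
        * intros k [<-|Hk]; [now left|right; auto].
        * simpl. lra. }
  eapply Rle_trans; [exact L|]. now apply H.
Qed.

Lemma sum_le_term (a : nat -> R) (M : R) (i : nat) : sum_le a M -> a i <= M.
Proof.
  intros H. specialize (H [i]). simpl in H.
  enough (a i + 0 <= M) by lra. apply H. constructor; [intros []|constructor].
Qed.

Lemma sum_le_vanish (a : nat -> R) (M eps : R) :
  sum_le a M -> 0 < eps -> exists N : nat, forall i, (N <= i)%nat -> a i < eps.
Proof.
  intros H He.
  destruct (classic (unbounded (fun i => eps <= a i))) as [U|U].
  (* With 1/n < eps / (|M| + 1), any n terms of size at least [eps] already sum to more than |M| +
     1. *)
  - exfalso. destruct (archimed_cor1 (eps / (Rabs M + 1))) as (n & Hn & Hn0).
    { apply Rdiv_lt_0_compat; auto. pose proof (Rabs_pos M). lra. }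
    destruct (unbounded_lists _ n U) as (l & ND & L & Hl).
    specialize (H l ND).
    assert (H1 : lsum (fun _ => eps) l <= lsum a l) by (apply lsum_le; auto).
    rewrite lsum_const, L in H1.
    assert (P : 0 < INR n) by (apply lt_0_INR; lia).
    pose proof (Rabs_pos M). pose proof (Rle_abs M).
    assert (Rabs M + 1 < INR n * eps).
    { apply Rmult_lt_compat_r with (r := INR n * (Rabs M + 1)) in Hn; [|nra].
      replace (/ INR n * (INR n * (Rabs M + 1))) with (Rabs M + 1) in Hn by (field; lra).
      replace (eps / (Rabs M + 1) * (INR n * (Rabs M + 1))) with (INR n * eps) in Hn
        by (field; lra). lra. }
    lra.
  - destruct (not_unbounded _ U) as [N HN]. exists N. intros i Hi.
    destruct (Rlt_le_dec (a i) eps) as [|C]; auto. specialize (HN i C). lia.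
Qed.

(** [M'] is the exact value of the sum, as a supremum over finite lists; a nearly optimal list is
    then enlarged to an initial segment of the indices. *)
Lemma sum_le_tight (a : nat -> R) (M eps : R) :
  (forall i, 0 <= a i) -> sum_le a M -> 0 < eps ->
  exists (M' : R) (N : nat), sum_le a M' /\ M' - eps < lsum a (seq 0 N).
Proof.
  intros Ha H He.
  destruct (completeness (fun r => exists l, NoDup l /\ r = lsum a l)) as [M' [UB LB]].
  - exists M. intros r (l & ND & ->). now apply H.
  - exists 0, []. split; [constructor|reflexivity].
  - destruct (classic (exists l, NoDup l /\ M' - eps < lsum a l)) as [(l & ND & Hl)|C].
    + exists M', (S (list_max l)). split.
      * intros k NDk. apply UB. now exists k.
      * eapply Rlt_le_trans; [exact Hl|]. apply lsum_incl; auto.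
        intros i Hi. apply in_seq. pose proof (proj1 (list_max_le l (list_max l)) (Nat.le_refl _)) as F.
        rewrite Forall_forall in F. specialize (F i Hi). lia.
    + exfalso. enough (M' <= M' - eps) by lra. apply LB. intros r (l & ND & ->).
      apply Rnot_lt_le. intros C'. apply C. now exists l.
Qed.

Lemma Lim_seq_sum_le (a : nat -> R) (M : R) :
  (forall i, 0 <= a i) -> sum_le a M ->
  exists r, r <= M /\ Lim_seq (fun n => sum_f_R0 a n) = Finite r.
Proof.
  intros Ha H.
  assert (B : forall n, sum_f_R0 a n <= M).
  { intros n. rewrite <- lsum_seq. apply H, seq_NoDup. }
  destruct (ex_finite_lim_seq_incr (fun n => sum_f_R0 a n) M) as [r Hr]; auto.
  { intros n. simpl. specialize (Ha (S n)). lra. }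
  exists r. split; [|now apply is_lim_seq_unique].
  apply (is_lim_seq_le (fun n => sum_f_R0 a n) (fun _ => M) r M); auto.
  apply is_lim_seq_const.
Qed.

Lemma sum_le_Lim_seq (a : nat -> R) (r : R) :
  (forall i, 0 <= a i) -> Lim_seq (fun n => sum_f_R0 a n) = Finite r -> sum_le a r.
Proof.
  intros Ha H l ND.
  assert (I : forall n, sum_f_R0 a n <= sum_f_R0 a (S n)).
  { intros n. simpl. specialize (Ha (S n)). lra. }
  assert (L : is_lim_seq (fun n => sum_f_R0 a n) r).
  { rewrite <- H. apply Lim_seq_correct, ex_lim_seq_incr, I. }
  apply Rle_trans with (sum_f_R0 a (list_max l)).
  - rewrite <- lsum_seq. apply lsum_incl; auto.
    intros i Hi. apply in_seq. pose proof (proj1 (list_max_le l (list_max l)) (Nat.le_refl _)) as F.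
    rewrite Forall_forall in F. specialize (F i Hi). lia.
  - apply is_lim_seq_incr_compare; auto.
Qed.

(** A finite head carries nearly all of the sum of |w|. A coordinatewise close [w'] has nearly the
    same head, and since its total is hardly larger, little is left for its tail. *)
Lemma sum_le_scheffe (w : nat -> R) (M eps : R) :
  sum_le (fun m => Rabs (w m)) M -> 0 < eps ->
  exists delta, 0 < delta /\ forall w' : nat -> R,
    (forall m, Rabs (w' m - w m) <= delta) ->
    (forall K, sum_le (fun m => Rabs (w m)) K -> sum_le (fun m => Rabs (w' m)) (K + delta)) ->
    sum_le (fun m => Rabs (w' m - w m)) eps.
Proof.
  intros H He.
  destruct (sum_le_tight _ M (eps / 8) (fun i => Rabs_pos (w i)) H) as (K & N & HK & HN); [lra|].
  assert (PN : 0 <= INR N) by apply pos_INR.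
  (* Chosen so that (N + 1) delta = eps / 8. The head then contributes at most eps / 8, the tail of
     [w'] at most 2 eps / 8 and the tail of [w] at most eps / 8. *)
  set (delta := eps / (8 * (INR N + 1))).
  assert (D : 0 < delta) by (apply Rdiv_lt_0_compat; lra).
  assert (DN : INR N * delta + delta = eps / 8) by (unfold delta; field; lra).
  assert (D0 : 0 <= INR N * delta) by nra.
  exists delta. split; auto. intros w' Hp Hs l ND.
  rewrite (lsum_filter _ (fun i => Nat.ltb i N)).
  set (l1 := filter _ l). set (l2 := filter _ l).
  assert (N1 : NoDup l1) by now apply NoDup_filter.
  (* The tail part of [l] is joined to the whole head, so that subtracting the head from the total
     bounds the tail. *)
  assert (N2 : NoDup (l2 ++ seq 0 N)).
  { apply NoDup_app; [now apply NoDup_filter|apply seq_NoDup|].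
    intros i Hi Hs'. apply filter_In in Hi. apply in_seq in Hs'. destruct Hi as [_ Hi].
    apply Bool.negb_true_iff, Nat.ltb_ge in Hi. lia. }
  assert (E1 : lsum (fun m => Rabs (w' m - w m)) l1 <= INR N * delta).
  { apply Rle_trans with (lsum (fun m => Rabs (w' m - w m)) (seq 0 N)).
    - apply lsum_incl; auto. { intros; apply Rabs_pos. }
      intros i Hi. apply filter_In in Hi. destruct Hi as [_ Hi].
      apply Nat.ltb_lt in Hi. apply in_seq. lia.
    - eapply Rle_trans; [apply lsum_le; intros i _; apply Hp|].
      rewrite lsum_const, length_seq. lra. }
  assert (E2 : lsum (fun m => Rabs (w m)) (seq 0 N) <=
               lsum (fun m => Rabs (w' m)) (seq 0 N) + INR N * delta).
  { rewrite <- (length_seq N 0) at 3. rewrite <- lsum_const, <- lsum_plus. apply lsum_le.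
    intros i _. specialize (Hp i). pose proof (Rabs_triang_inv (w i) (w' i)).
    rewrite Rabs_minus_sym in Hp. lra. }
  pose proof (Hs K HK _ N2) as E3. pose proof (HK _ N2) as E4.
  rewrite lsum_app in E3, E4.
  assert (E5 : lsum (fun m => Rabs (w' m - w m)) l2 <=
               lsum (fun m => Rabs (w' m)) l2 + lsum (fun m => Rabs (w m)) l2).
  { rewrite <- lsum_plus. apply lsum_le. intros i _.
    unfold Rminus. eapply Rle_trans; [apply Rabs_triang|]. rewrite Rabs_Ropp. lra. }
  lra.
Qed.

(** * Enumerations of rigged sets *)

Lemma enum_exists {X : Type} (s : nat -> X) : exists S, is_enum X S s.
Proof.
  apply (fun_choice X (option nat) (fun x m => match m with
            | None => forall N : nat, exists j : nat, (N <= j)%nat /\ s j = x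
            | Some n => exists l : list nat,
                length l = n /\ NoDup l /\ (forall j, In j l <-> s j = x)
            end)).
  intros x. destruct (classic (unbounded (fun j => s j = x))) as [U|U].
  - exists None. exact U.
  - destruct (not_unbounded _ U) as [N HN].
    destruct (bounded_list _ N HN) as (l & ND & Hl).
    exists (Some (length l)). now exists l.
Qed.

Lemma enum_infinite {X : Type} (S : rigged X) (s : nat -> X) (x : X) :
  is_enum X S s -> (S x = None <-> unbounded (fun j => s j = x)).
Proof.
  intros H. specialize (H x). destruct (S x) as [n|].
  - split; [discriminate|]. intros U. exfalso. destruct H as (l & L & ND & Hl).
    destruct (unbounded_lists _ (Datatypes.S n) U) as (k & NDk & Lk & Hk).
    assert (length k <= length l)%nat by (apply NoDup_incl_length; auto; intros i Hi; now apply Hl, Hk).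
    lia.
  - split; auto.
Qed.

Lemma enum_support {X : Type} (S : rigged X) (s : nat -> X) (x : X) :
  is_enum X S s -> (S x <> Some 0%nat <-> exists j, s j = x).
Proof.
  intros H. specialize (H x). destruct (S x) as [[|n]|].
  - split; [congruence|]. intros [j Hj]. destruct H as ([|i l] & L & ND & Hl); [|discriminate].
    now apply Hl in Hj.
  - split; [|congruence]. intros _. destruct H as ([|i l] & L & ND & Hl); [discriminate|].
    exists i. apply Hl. now left.
  - split; [|congruence]. intros _. destruct (H 0%nat) as (j & _ & Hj). now exists j.
Qed.

(** The injection is built fibre by fibre: finite fibres over the same point have equal size, and
    any fibre embeds in an infinite one. Using the lemma in both directions replaces a bijection
    between enumerations. *)
Lemma enum_embed {X : Type} (S : rigged X) (s t : nat -> X) :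
  is_enum X S s -> is_enum X S t -> exists f, Injective f /\ forall i, t (f i) = s i.
Proof.
  intros Hs Ht.
  assert (F : forall x, exists g : nat -> nat, (forall i, s i = x -> t (g i) = x) /\
              forall i j, s i = x -> s j = x -> g i = g j -> i = j).
  { intros x. specialize (Hs x). specialize (Ht x). destruct (S x) as [n|].
    - destruct Hs as (k & Lk & _ & Hk), Ht as (l & Ll & ND & Hl).
      destruct (list_injection k l ND) as (g & G1 & G2); [lia|].
      exists g. split.
      + intros i Hi. now apply Hl, G1, Hk.
      + intros i j Hi Hj. apply G2; now apply Hk.
    - destruct (unbounded_inj _ Ht) as [g [Ig Hg]]. exists g. split; auto. }
  destruct (fun_choice _ _ _ F) as [g Hg].
  exists (fun i => g (s i) i). split.
  - intros i j E.
    assert (E' : s i = s j).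
    { rewrite <- (proj1 (Hg (s i)) i eq_refl), <- (proj1 (Hg (s j)) j eq_refl). now rewrite E. }
    apply (proj2 (Hg (s j))); auto. rewrite <- E' at 1. exact E.
  - intros i. now apply Hg.
Qed.

(** The extra slots outside the range of [c] hold the base point, whose multiplicity is already
    infinite, so inserting them changes no multiplicity. *)
Lemma enum_reindex {X : Type} (S : rigged X) (x0 : X) (h y : nat -> X) (c : nat -> nat) :
  is_enum X S h -> S x0 = None -> Injective c -> (forall i, y (c i) = h i) ->
  (forall m, (forall i, c i <> m) -> y m = x0) -> is_enum X S y.
Proof.
  intros H H0 Ic Hc Hy x. pose proof (H x) as Hx. destruct (S x) as [n|] eqn:E.
  - destruct Hx as (l & L & ND & Hl). exists (map c l).
    rewrite length_map. split; [|split]; auto.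
    + now apply Injective_map_NoDup.
    + intros j. rewrite in_map_iff. split.
      * intros (i & <- & Hi). rewrite Hc. now apply Hl.
      * intros Hj. destruct (classic (exists i, c i = j)) as [[i <-]|C].
        -- exists i. split; auto. apply Hl. now rewrite <- Hc.
        -- assert (y j = x0) by (apply Hy; intros i Hi; apply C; now exists i). congruence.
  - change (unbounded (fun j => y j = x)). apply unbounded_of_lists. intros n.
    destruct (unbounded_lists _ n Hx) as (l & ND & L & Hl).
    exists (map c l). rewrite length_map. split; [|split]; auto.
    + now apply Injective_map_NoDup.
    + intros j Hj. apply in_map_iff in Hj. destruct Hj as (i & <- & Hi). rewrite Hc. now apply Hl.
Qed.

(** Turns the sum of multiplicities used in [pushforward] into a count of indices. *)
Lemma enum_of_list {X : Type} (S : rigged X) (s : nat -> X) (L : list X) :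
  is_enum X S s -> NoDup L -> (forall x, In x L -> S x <> None) ->
  exists l, NoDup l /\ (forall j, In j l <-> In (s j) L) /\
    length l = fold_right (fun x acc => (mult_val (S x) + acc)%nat) 0%nat L.
Proof.
  intros H. induction L as [|x L IH]; intros ND HN.
  - exists []. split; [constructor|]. split; [tauto|reflexivity].
  - inversion_clear ND as [|? ? Hx ND'].
    destruct (IH ND') as (l & N & I & E); [intros z Hz; apply HN; now right|].
    pose proof (HN x (or_introl eq_refl)) as Hn. pose proof (H x) as Ex.
    simpl. destruct (S x) as [n|]; [|congruence]. destruct Ex as (k & Lk & Nk & Hk).
    exists (k ++ l). split; [|split].
    + apply NoDup_app; auto. intros j Hj Hj'. apply Hx. apply Hk in Hj. subst x. now apply I.
    + intros j. rewrite in_app_iff, Hk, I. split; intros [A|A]; auto.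
    + rewrite length_app, Lk, E. reflexivity.
Qed.

(** * Summable rigged sets and the distance between them *)

Lemma rdist_lt_enum {X : Type} (dist : X -> X -> R)
      (dist_nonneg : forall x y, 0 <= dist x y)
      (S T : rigged X) (eps : R) :
  Rbar_lt (rdist X dist S T) eps ->
  exists s t, is_enum X S s /\ is_enum X T t /\ sum_le (fun j => dist (s j) (t j)) eps.
Proof.
  intros H. apply NNPP. intros C.
  assert (G : Rbar_le eps (rdist X dist S T)).
  { unfold rdist. apply Glb_Rbar_correct. intros r (s & t & Hs & Ht & E).
    apply Rnot_lt_le. intros L. apply C. exists s, t. split; [|split]; auto.
    intros l ND. apply Rle_trans with r; [|lra].
    revert l ND. now apply sum_le_Lim_seq. }
  apply (Rbar_lt_not_le _ _ H G).
Qed.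

Lemma rdist_le_enum {X : Type} (dist : X -> X -> R)
      (dist_nonneg : forall x y, 0 <= dist x y)
      (S T : rigged X) (s t : nat -> X) (M : R) :
  is_enum X S s -> is_enum X T t -> sum_le (fun j => dist (s j) (t j)) M ->
  Rbar_le (rdist X dist S T) M.
Proof.
  intros Hs Ht H. destruct (Lim_seq_sum_le _ _ (fun j => dist_nonneg (s j) (t j)) H) as (r & L & E).
  apply Rbar_le_trans with r; [|exact L].
  unfold rdist. apply Glb_Rbar_correct. exists s, t. auto.
Qed.

(** Every enumeration of [bold_base] is constant, so a finite distance to it is a summability
    statement about one enumeration of [S]. *)
Lemma S_one_enum {X : Type} (dist : X -> X -> R)
      (dist_nonneg : forall x y, 0 <= dist x y)
      (x0 : X) (S : rigged X) :
  S_one X dist x0 S -> exists s M, is_enum X S s /\ sum_le (fun j => dist (s j) x0) M.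
Proof.
  intros [_ H].
  assert (exists M : R, Rbar_lt (rdist X dist S (bold_base X x0)) M) as [M HM].
  { destruct (rdist X dist S (bold_base X x0)) as [r| |].
    - exists (r + 1). simpl. lra.
    - contradiction.
    - exists 0. exact I. }
  destruct (rdist_lt_enum dist dist_nonneg _ _ _ HM) as (s & t & Hs & Ht & Hst).
  exists s, M. split; auto.
  revert Hst. apply sum_le_mono. intros i.
  enough (t i = x0) as -> by lra.
  assert (B : bold_base X x0 (t i) <> Some 0%nat) by (apply (enum_support _ _ _ Ht); now exists i).
  unfold bold_base in B. destruct (excluded_middle_informative (t i = x0)); congruence.
Qed.

Lemma S_one_base {X : Type} (dist : X -> X -> R) (x0 : X) (S : rigged X) : S_one X dist x0 S -> S x0 = None.
Proof. intros [(_ & H & _) _]. exact H. Qed.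

Lemma enum_bold_base {X : Type} (x0 : X) : is_enum X (bold_base X x0) (fun _ => x0).
Proof.
  intros x. unfold bold_base. destruct (excluded_middle_informative (x = x0)) as [->|N].
  - intros N. exists N. auto.
  - exists []. split; [reflexivity|]. split; [constructor|].
    intros j. split; [intros []|]. congruence.
Qed.

Lemma distR_nonneg (x y : R) : 0 <= distR x y.
Proof. apply Rabs_pos. Qed.

Lemma S_one_of_enum (S : rigged R) (s : nat -> R) (M : R) :
  is_enum R S s -> sum_le (fun j => Rabs (s j)) M -> unbounded (fun j => s j = 0) ->
  S_one R distR 0 S.
Proof.
  intros H HM U. split; [split; [|split]|].
  - exists s. intros x Hx. now apply (enum_support _ _ _ H).
  - now apply (enum_infinite _ _ _ H).
  - intros a Ha. apply NNPP. intros Na.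
    assert (P : 0 < Rabs a) by now apply Rabs_pos_lt.
    (* Members closer than |a| / 2 to [a] have absolute value above |a| / 2, and summability allows
       only finitely many indices of that kind. *)
    apply (Ha (Rabs a / 2)); [lra|].
    destruct (sum_le_vanish _ _ (Rabs a / 2) HM) as [N HN]; [lra|].
    assert (B : forall j, Defs.ball R distR a (Rabs a / 2) (s j) -> (j < N)%nat).
    { intros j Hj. destruct (Nat.lt_ge_cases j N) as [|L]; auto. specialize (HN j L).
      unfold Defs.ball, distR in Hj. pose proof (Rabs_triang_inv a (s j)). lra. }
    exists (map s (seq 0 N)). intros x Hx Sx. apply (enum_support _ _ _ H) in Sx.
    destruct Sx as [j <-]. split.
    + apply in_map, in_seq. specialize (B j Hx). lia.
    + intros C. apply (enum_infinite _ _ _ H) in C. destruct (C N) as (i & Hi & E).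
      rewrite <- E in Hx. specialize (B i Hx). lia.
  - apply Rbar_le_lt_trans with M; [|exact I].
    apply (rdist_le_enum distR distR_nonneg _ _ s (fun _ => 0)); auto.
    + apply enum_bold_base.
    + revert HM. apply sum_le_mono. intros i. unfold distR. rewrite Rminus_0_r. lra.
Qed.

(** * The covering map of the circle *)

Lemma cos_sin_circle (u : R) : fst (cos u, sin u) ^ 2 + snd (cos u, sin u) ^ 2 = 1.
Proof. simpl. pose proof (sin2_cos2 u) as H. unfold Rsqr in H. lra. Qed.

Definition expi (u : R) : Tcirc := exist _ (cos u, sin u) (cos_sin_circle u).

Lemma Tcirc_eq (z w : Tcirc) : proj1_sig z = proj1_sig w -> z = w.
Proof.
  destruct z as [z Hz], w as [w Hw]. simpl. intros ->. f_equal. apply proof_irrelevance.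
Qed.

Lemma expi_spec (z : Tcirc) (u : R) : proj1_sig z = (cos u, sin u) <-> expi u = z.
Proof. split; [|intros <-; reflexivity]. intros E. apply Tcirc_eq. now symmetry. Qed.

Lemma expi_0 : expi 0 = T_one.
Proof. apply Tcirc_eq. simpl. now rewrite cos_0, sin_0. Qed.

(** The multiplicity of [z] counts the indices over [z]; grouping these indices by the real value
    [s i] gives the sum over the fibre. *)
Lemma push_of_enum (S : rigged R) (S' : rigged Tcirc) (s : nat -> R) :
  is_enum R S s -> is_enum Tcirc S' (fun i => expi (s i)) -> pushforward S S'.
Proof.
  intros H H' z A. pose proof (H' z) as Hz. pose proof (enum_infinite _ _ z H') as Iz.
  destruct (S' z) as [n|].
  - destruct Hz as (l & L & ND & Hl).
    set (K := nodup Req_EM_T (map s l)).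
    assert (HK : forall th, In th K <-> exists j, s j = th /\ expi (s j) = z).
    { intros th. unfold K. rewrite nodup_In, in_map_iff.
      split; intros (j & E & Hj); exists j; split; auto; now apply Hl. }
    assert (FK : forall th, In th K -> S th <> None).
    { intros th Hth C. apply HK in Hth. destruct Hth as (j & <- & E).
      apply (enum_infinite _ _ _ H) in C. apply proj2 in Iz.
      enough (Some n = None) by discriminate. apply Iz. intros N. destruct (C N) as (i & Hi & Ei).
      exists i. split; auto. now rewrite Ei. }
    exists K. split; [apply NoDup_nodup|]. split; [|split; auto].
    + intros th. rewrite HK. unfold A. rewrite expi_spec, (enum_support _ _ _ H). split.
      * intros (j & <- & E). split; auto. now exists j.
      * intros (E & j & <-). now exists j.
    + destruct (enum_of_list S s K H (NoDup_nodup _ _) FK) as (k & Nk & Ik & <-).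
      rewrite <- L. apply Nat.le_antisymm; apply NoDup_incl_length; auto; intros j Hj.
      * apply Hl. apply Ik, HK in Hj. destruct Hj as (i & E & E'). now rewrite <- E.
      * apply Ik, HK. exists j. split; auto. now apply Hl.
  - intros [L HL].
    (* [L] may also contain points off the fibre, possibly of infinite multiplicity; filtering keeps
       only those for which [HL] guarantees a finite one. *)
    destruct (enum_of_list S s (filter (fun th => if excluded_middle_informative (A th /\ S th <> Some 0%nat) then true else false) (nodup Req_EM_T L)) H) as (k & Nk & Ik & _).
    { apply NoDup_filter, NoDup_nodup. }
    { intros th Hth. apply filter_In in Hth. destruct Hth as [_ Hth].
      destruct (excluded_middle_informative _) as [[a b]|]; [|discriminate]. now apply HL. }
    destruct (Hz (Datatypes.S (list_max k))) as (j & Lj & Hj).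
    enough (In j k).
    { pose proof (proj1 (list_max_le k (list_max k)) (Nat.le_refl _)) as F.
      rewrite Forall_forall in F. specialize (F j H0). lia. }
    apply Ik.
    assert (a : A (s j)) by (unfold A; now rewrite expi_spec).
    assert (b : S (s j) <> Some 0%nat) by (apply (enum_support _ _ _ H); now exists j).
    apply filter_In. split; [apply nodup_In; now apply HL|].
    destruct (excluded_middle_informative _); tauto.
Qed.

Lemma enum_of_push (S : rigged R) (S' : rigged Tcirc) (s : nat -> R) :
  is_enum R S s -> pushforward S S' -> is_enum Tcirc S' (fun i => expi (s i)).
Proof.
  intros H Hp z. specialize (Hp z). simpl in Hp.
  assert (Sj : forall j, S (s j) <> Some 0%nat) by (intros j; apply (enum_support _ _ _ H); now exists j).
  destruct (S' z) as [n|].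
  - destruct Hp as (L & ND & HL & FL & <-).
    destruct (enum_of_list S s L H ND FL) as (k & Nk & Ik & <-).
    exists k. split; [|split]; auto. intros j. rewrite Ik, HL, expi_spec. specialize (Sj j). tauto.
  (* If only finitely many indices lay over [z], their values would form the finite list that
     [pushforward] excludes. *)
  - change (unbounded (fun j => expi (s j) = z)). apply NNPP. intros C.
    destruct (not_unbounded _ C) as [N HN]. apply Hp. exists (map s (seq 0 N)).
    intros th Hth Sth. apply expi_spec in Hth. apply (enum_support _ _ _ H) in Sth.
    destruct Sth as [j <-]. split.
    + apply in_map, in_seq. specialize (HN j Hth). lia.
    + intros U. apply (enum_infinite _ _ _ H) in U. destruct (U N) as (i & Hi & E).
      rewrite <- E in Hth. specialize (HN i Hth). lia.
Qed.

Lemma expi_period (u : R) (k : Z) : expi (u + 2 * PI * IZR k) = expi u.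
Proof.
  assert (N : forall (n : nat) v, expi (v + 2 * PI * IZR (Z.of_nat n)) = expi v).
  { intros n v. apply Tcirc_eq. simpl. rewrite <- INR_IZR_INZ.
    replace (v + 2 * PI * INR n) with (v + 2 * INR n * PI) by ring.
    now rewrite cos_period, sin_period. }
  destruct (Z.le_gt_cases 0 k) as [L|L].
  - rewrite <- (Z2Nat.id k L). apply N.
  - rewrite <- (N (Z.to_nat (- k)) (u + 2 * PI * IZR k)). f_equal.
    rewrite Z2Nat.id by lia. rewrite opp_IZR. ring.
Qed.

Lemma mod_2PI (u c : R) : exists k : Z, c - PI < u + 2 * PI * IZR k <= c + PI.
Proof.
  pose proof PI_RGT_0 as HP.
  destruct (archimed ((c - PI - u) / (2 * PI))) as [A1 A2].
  exists (up ((c - PI - u) / (2 * PI))).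
  set (k := IZR (up _)) in *.
  assert (E : 2 * PI * ((c - PI - u) / (2 * PI)) = c - PI - u) by (field; lra).
  set (r := (c - PI - u) / (2 * PI)) in *. clearbody k r.
  apply Rmult_lt_compat_l with (r := 2 * PI) in A1; [|lra].
  apply Rmult_le_compat_l with (r := 2 * PI) in A2; [|lra].
  split; lra.
Qed.

Lemma expi_surj (z : Tcirc) : exists u, expi u = z.
Proof.
  destruct z as [[x y] Hz]. simpl in Hz.
  assert (B : -1 <= x <= 1) by nra.
  assert (Y : y = sin (acos x) \/ y = - sin (acos x)).
  { assert (E : y ^ 2 = sin (acos x) ^ 2).
    { pose proof (sin2_cos2 (acos x)) as H. unfold Rsqr in H. rewrite (cos_acos x B) in H. nra. }
    assert (F : (y - sin (acos x)) * (y + sin (acos x)) = 0) by lra.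
    apply Rmult_integral in F. destruct F; [left|right]; lra. }
  destruct Y as [Y|Y]; [exists (acos x)|exists (- acos x)]; apply Tcirc_eq; simpl.
  - rewrite cos_acos by exact B. now f_equal.
  - rewrite cos_neg, sin_neg, cos_acos by exact B. now f_equal.
Qed.

(** The difference is first reduced to [-pi, pi]; there its cosine is 1 only at 0, by injectivity of
    the cosine on [0, pi]. *)
Lemma expi_eq (u v : R) : expi u = expi v -> exists k : Z, u = v + 2 * PI * IZR k.
Proof.
  intros E. destruct (mod_2PI (v - u) 0) as [k Hk].
  assert (C : cos (v - u + 2 * PI * IZR k) = 1).
  { assert (E' : cos u = cos v /\ sin u = sin v).
    { apply (f_equal (@proj1_sig _ _)) in E. simpl in E. now inversion E. }
    pose proof (expi_period (v - u) k) as P. apply (f_equal (@proj1_sig _ _)) in P.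
    simpl in P. inversion P as [[P1 P2]]. rewrite P1, cos_minus.
    destruct E' as [-> ->]. pose proof (sin2_cos2 v) as H. unfold Rsqr in H. lra. }
  set (d := v - u + 2 * PI * IZR k) in *.
  assert (D : d = 0).
  { pose proof (acos_cos (Rabs d)) as A.
    assert (cos (Rabs d) = 1).
    { unfold Rabs. destruct (Rcase_abs d); auto. now rewrite cos_neg. }
    rewrite H in A. rewrite acos_1 in A.
    destruct (Req_dec d 0) as [|Nd]; auto. exfalso. apply (Rabs_no_R0 d Nd). symmetry. apply A.
    split; [apply Rabs_pos|]. apply Rabs_le. lra. }
  exists k. unfold d in D. lra.
Qed.

Lemma distT_expi (u v : R) : distT (expi u) (expi v) = acos (cos (u - v)).
Proof. unfold distT. simpl. now rewrite cos_minus. Qed.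

Lemma distT_nonneg (z w : Tcirc) : 0 <= distT z w.
Proof. unfold distT. apply acos_bound. Qed.

Lemma distT_near (u v : R) : Rabs (u - v) <= PI -> distT (expi u) (expi v) = Rabs (u - v).
Proof.
  intros H. rewrite distT_expi.
  replace (cos (u - v)) with (cos (Rabs (u - v))).
  - apply acos_cos. split; [apply Rabs_pos|exact H].
  - unfold Rabs. destruct (Rcase_abs (u - v)); auto. now rewrite cos_neg.
Qed.

Lemma distT_lift (z : Tcirc) (v : R) :
  exists u, expi u = z /\ Rabs (u - v) = distT z (expi v) /\ Rabs (u - v) <= PI.
Proof.
  destruct (expi_surj z) as [u <-]. destruct (mod_2PI u v) as [k Hk].
  exists (u + 2 * PI * IZR k). rewrite <- (expi_period u k).
  assert (B : Rabs (u + 2 * PI * IZR k - v) <= PI) by (apply Rabs_le; lra).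
  split; auto. split; auto. now rewrite distT_near.
Qed.

Lemma IZR_small (k : Z) : -1 < IZR k < 1 -> k = 0%Z.
Proof. intros [H1 H2]. apply lt_IZR in H1. apply lt_IZR in H2. lia. Qed.

Lemma expi_inj (u v : R) : Rabs (u - v) < 2 * PI -> expi u = expi v -> u = v.
Proof.
  intros H E. apply expi_eq in E. destruct E as [k E].
  pose proof PI_RGT_0. apply Rabs_def2 in H.
  rewrite (IZR_small k) in E by (split; nra). lra.
Qed.

(** * Sorting a null sequence *)

Definition null_seq (v : nat -> R) :=
  forall eps, 0 < eps -> exists N : nat, forall i, (N <= i)%nat -> Rabs (v i) < eps.

(** The decreasing rearrangement of the positive part of [v]: [p j] is the value of rank j counted
    from 0, or 0 if there are too few positive values. Stating it through superlevel sets determines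
    [p] uniquely and makes comparison of two copies a matter of counting. *)
Definition decreasing_copy (v p : nat -> R) :=
  (forall j, 0 <= p j) /\
  forall j x, 0 < x ->
    (x <= p j <-> exists l, NoDup l /\ length l = S j /\ forall i, In i l -> x <= v i).

(** The j + 1 indices where [v] is at least [p j] are carried by [f] to as many indices where [v']
    is at least [p j - delta]. If that level is not positive, [0 <= p' j] suffices. *)
Lemma decreasing_copy_lip (v v' p p' : nat -> R) (f : nat -> nat) (delta : R) (j : nat) :
  decreasing_copy v p -> decreasing_copy v' p' -> Injective f -> 0 <= delta ->
  (forall i, v i <= v' (f i) + delta) -> p j <= p' j + delta.
Proof.
  intros [P1 P2] [P1' P2'] If Hd H.
  destruct (Rle_lt_dec (p j) delta) as [L|L]; [specialize (P1' j); lra|].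
  destruct (proj1 (P2 j (p j) ltac:(lra)) ltac:(lra)) as (l & ND & Ll & Hl).
  enough (p j - delta <= p' j) by lra.
  apply P2'; [lra|]. exists (map f l). split; [|split].
  - now apply Injective_map_NoDup.
  - now rewrite length_map.
  - intros i Hi. apply in_map_iff in Hi. destruct Hi as (k & <- & Hk).
    specialize (H k). specialize (Hl k Hk). lra.
Qed.

Lemma last_in_order (before : nat -> nat -> Prop) (l : list nat) :
  (forall i j k, before i j -> before j k -> before i k) ->
  (forall i j, i = j \/ before i j \/ before j i) ->
  l <> [] -> exists i, In i l /\ forall k, In k l -> k = i \/ before k i.
Proof.
  intros Tr Tot. induction l as [|a l IH]; [congruence|]. intros _.
  destruct l as [|b l].
  - exists a. split; [now left|]. intros k [<-|[]]. now left.
  - destruct IH as (i & Hi & M); [discriminate|].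
    destruct (Tot a i) as [->|[H|H]].
    + exists i. split; [now left|]. intros k [<-|Hk]; auto.
    + exists i. split; [now right|]. intros k [<-|Hk]; auto.
    + exists a. split; [now left|]. intros k [<-|Hk]; auto.
      right. destruct (M k Hk) as [->|Hk']; eauto.
Qed.

(* [rho i] is the number of indices before [i] when the values are arranged in decreasing order, ties broken by the index. *)
Lemma decreasing_copy_exists (v : nat -> R) :
  null_seq v ->
  exists (p : nat -> R) (rho : nat -> nat), decreasing_copy v p /\
    (forall i, 0 < v i -> p (rho i) = v i) /\
    (forall i j, 0 < v i -> 0 < v j -> rho i = rho j -> i = j) /\
    (forall j, 0 < p j -> exists i, 0 < v i /\ rho i = j).
Proof.
  intros Hv.
  set (before := fun k i : nat => v i < v k \/ (v i = v k /\ (k < i)%nat)).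
  assert (Tr : forall i j k, before i j -> before j k -> before i k).
  { unfold before. intros i j k [A|[A A']] [B|[B B']]; try (left; lra). right. split; [lra|lia]. }
  assert (Tot : forall i j, i = j \/ before i j \/ before j i).
  { unfold before. intros i j. destruct (Nat.lt_trichotomy i j) as [A|[A|A]]; auto;
      destruct (Rtotal_order (v i) (v j)) as [B|[B|B]]; auto. }
  assert (Irr : forall i, ~ before i i) by (unfold before; intros i [A|[_ A]]; [lra|lia]).
  (* A positive value of a null sequence has only finitely many predecessors. *)
  assert (F : forall i, exists L, 0 < v i -> NoDup L /\ forall k, In k L <-> before k i).
  { intros i. destruct (Rle_lt_dec (v i) 0) as [A|A].
    - exists []. lra.
    - destruct (Hv (v i) A) as [N HN].
      destruct (bounded_list (fun k => before k i) (Nat.max N i)) as (L & H).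
      + intros k Hk. destruct (Nat.lt_ge_cases k (Nat.max N i)) as [|C]; auto.
        assert (C' : (N <= k)%nat) by lia.
        pose proof (HN k C'). pose proof (Rle_abs (v k)). destruct Hk as [Hk|[_ Hk]]; [lra|lia].
      + exists L. auto. }
  destruct (fun_choice _ _ _ F) as [L HL]. clear F.
  set (rho := fun i => length (L i)).
  assert (Rho_lt : forall i j, 0 < v i -> 0 < v j -> before i j -> (rho i < rho j)%nat).
  { intros i j Pi Pj B. destruct (HL i Pi) as [Ni Hi]. destruct (HL j Pj) as [Nj Hj].
    apply (NoDup_incl_length (l := i :: L i)).
    - constructor; auto. rewrite Hi. apply Irr.
    - intros k [<-|Hk]; [now apply Hj|]. apply Hj. apply Hi in Hk. eauto. }
  assert (Rho_inj : forall i j, 0 < v i -> 0 < v j -> rho i = rho j -> i = j).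
  { intros i j Pi Pj E. destruct (Tot i j) as [|[B|B]]; auto; exfalso;
      apply Rho_lt in B; auto; lia. }
  (* All ranks below |K| occur in a finite set [K] closed under predecessors: remove its last
     element until j + 1 remain; the last of those has exactly j predecessors. *)
  assert (Closed : forall n j K, length K = (n + S j)%nat -> NoDup K ->
            (forall i, In i K -> 0 < v i) -> (forall i k, In i K -> before k i -> In k K) ->
            exists i, In i K /\ rho i = j).
  { induction n as [|n IH]; intros j K LK ND PK CK.
    - destruct (last_in_order before K Tr Tot) as (i & Hi & Mi); [now intros ->|].
      exists i. split; auto. destruct (HL i (PK i Hi)) as [Ni HLi].
      enough (length (i :: L i) = length K) by (unfold rho; simpl in *; lia).
      apply Nat.le_antisymm; apply NoDup_incl_length; auto.
      + constructor; auto. rewrite HLi. apply Irr.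
      + intros k [<-|Hk]; auto. apply HLi in Hk. eauto.
      + intros k Hk. destruct (Mi k Hk) as [->|B]; [now left|right; now apply HLi].
    - destruct (last_in_order before K Tr Tot) as (i & Hi & Mi); [now intros ->|].
      destruct (in_split i K Hi) as (K1 & K2 & ->).
      pose proof (NoDup_remove_1 _ _ _ ND) as ND'. pose proof (NoDup_remove_2 _ _ _ ND) as Ni.
      assert (Sub : forall k, In k (K1 ++ K2) -> In k (K1 ++ i :: K2)).
      { intros k Hk. apply in_app_iff in Hk. apply in_app_iff. simpl. tauto. }
      destruct (IH j (K1 ++ K2)) as (k & Hk & E).
      + rewrite length_app in *. simpl in LK. lia.
      + exact ND'.
      + intros k Hk. auto.
      + intros k m Hk Hm. pose proof (CK k m (Sub k Hk) Hm) as Im.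
        apply in_app_iff in Im. apply in_app_iff. destruct Im as [|[<-|]]; auto.
        exfalso. destruct (Mi k (Sub k Hk)) as [->|B]; [contradiction|].
        apply (Irr i). eauto.
      + exists k. split; auto. }
  assert (F : forall j, exists r, (exists i, 0 < v i /\ rho i = j /\ r = v i) \/
                                  ((forall i, 0 < v i -> rho i <> j) /\ r = 0)).
  { intros j. destruct (classic (exists i, 0 < v i /\ rho i = j)) as [(i & A & B)|C].
    - exists (v i). left. exists i. auto.
    - exists 0. right. split; auto. intros i A B. apply C. now exists i. }
  destruct (fun_choice _ _ _ F) as [p Hp]. clear F.
  exists p, rho. split; [split|split; [|split]]; auto.
  - intros j. destruct (Hp j) as [(i & A & _ & ->)|[_ ->]]; lra.
  - intros j x Px. split.
    + intros Hx. destruct (Hp j) as [(i & A & B & E)|[_ E]]; [|lra].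
      destruct (HL i A) as [Ni HLi]. exists (i :: L i). split; [|split].
      * constructor; auto. rewrite HLi. apply Irr.
      * simpl. unfold rho in B. now rewrite B.
      * intros k [<-|Hk]; [lra|]. apply HLi in Hk. destruct Hk as [Hk|[Hk _]]; lra.
    + intros (l & ND & Ll & Hl).
      destruct (Hv x Px) as [N HN].
      destruct (bounded_list (fun k => x <= v k) N) as (K & NK & HK).
      { intros k Hk. destruct (Nat.lt_ge_cases k N) as [|C]; auto.
        pose proof (HN k C). pose proof (Rle_abs (v k)). lra. }
      assert (LK : (S j <= length K)%nat).
      { rewrite <- Ll. apply NoDup_incl_length; auto. intros k Hk. apply HK; auto. }
      destruct (Closed (length K - S j)%nat j K) as (i & Hi & E); auto.
      * lia.
      * intros i Hi. apply HK in Hi. lra.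
      * intros i k Hi B. apply HK in Hi. apply HK. destruct B as [B|[B _]]; lra.
      * apply HK in Hi. destruct (Hp j) as [(i' & A' & E' & ->)|[C _]].
        -- assert (i' = i) as -> by (apply Rho_inj; auto; [lra|congruence]). exact Hi.
        -- exfalso. apply (C i); auto. lra.
  - intros i Pi. destruct (Hp (rho i)) as [(k & A & B & ->)|[C _]].
    + now rewrite (Rho_inj k i).
    + exfalso. now apply (C i).
  - intros j Pj. destruct (Hp j) as [(i & A & B & _)|[_ E]]; [now exists i|lra].
Qed.

(* Positive and negative values are sorted separately, so that every term of [w] is a 1-Lipschitz function of [v]; the null terms at the indices [4 j + 3] keep room for particles at the base point. *)
Definition sorted_copy (v w : nat -> R) :=
  decreasing_copy v (fun j => w (2 * j)%nat) /\
  decreasing_copy (fun i => - v i) (fun j => - w (4 * j + 1)%nat) /\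
  (forall j, w (4 * j + 3)%nat = 0) /\
  exists c, Injective c /\ (forall i, w (c i) = v i) /\
    (forall m, (forall i, c i <> m) -> w m = 0) /\
    (forall i, v i = 0 -> c i = (4 * i + 3)%nat).

Lemma index_cases (m : nat) :
  exists j, m = (2 * j)%nat \/ m = (4 * j + 1)%nat \/ m = (4 * j + 3)%nat.
Proof.
  destruct (Nat.Even_or_Odd m) as [[k E]|[k E]]; [exists k; lia|].
  destruct (Nat.Even_or_Odd k) as [[j F]|[j F]]; exists j; lia.
Qed.

(** Each injection yields one of the two inequalities, so no bijection between the families is
    required. *)
Lemma sorted_copy_lip (v v' w w' : nat -> R) (f g : nat -> nat) (delta : R) :
  sorted_copy v w -> sorted_copy v' w' -> Injective f -> Injective g ->
  (forall i, Rabs (v i - v' (f i)) <= delta) -> (forall i, Rabs (v (g i) - v' i) <= delta) ->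
  forall m, Rabs (w m - w' m) <= delta.
Proof.
  intros (A & B & C & _) (A' & B' & C' & _) If Ig Hf Hg m.
  assert (D : 0 <= delta) by (eapply Rle_trans; [apply Rabs_pos|apply (Hf 0%nat)]).
  assert (Hf' : forall i, - delta <= v i - v' (f i) <= delta).
  { intros i. specialize (Hf i). split; [|eapply Rle_trans; [apply Rle_abs|exact Hf]].
    pose proof (Rle_abs (- (v i - v' (f i)))). rewrite Rabs_Ropp in H. lra. }
  assert (Hg' : forall i, - delta <= v (g i) - v' i <= delta).
  { intros i. specialize (Hg i). split; [|eapply Rle_trans; [apply Rle_abs|exact Hg]].
    pose proof (Rle_abs (- (v (g i) - v' i))). rewrite Rabs_Ropp in H. lra. }
  destruct (index_cases m) as [j [-> | [-> | ->]]]; apply Rabs_le.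
  - pose proof (decreasing_copy_lip _ _ _ _ f delta j A A' If D ltac:(intros i; specialize (Hf' i); lra)).
    pose proof (decreasing_copy_lip _ _ _ _ g delta j A' A Ig D ltac:(intros i; specialize (Hg' i); lra)).
    simpl in *. lra.
  - pose proof (decreasing_copy_lip _ _ _ _ f delta j B B' If D ltac:(intros i; simpl; specialize (Hf' i); lra)).
    pose proof (decreasing_copy_lip _ _ _ _ g delta j B' B Ig D ltac:(intros i; simpl; specialize (Hg' i); lra)).
    cbv beta in *. lra.
  - rewrite C, C'. lra.
Qed.

Lemma sorted_copy_exists (v : nat -> R) : null_seq v -> exists w, sorted_copy v w.
Proof.
  intros Hv.
  destruct (decreasing_copy_exists v Hv) as (p & rho & Dp & P1 & P2 & P3).
  destruct (decreasing_copy_exists (fun i => - v i)) as (q & sigma & Dq & Q1 & Q2 & Q3).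
  { intros eps He. destruct (Hv eps He) as [N HN]. exists N. intros i Hi. rewrite Rabs_Ropp. auto. }
  assert (F : forall m, exists r, forall j, (m = (2 * j)%nat -> r = p j) /\
              (m = (4 * j + 1)%nat -> r = - q j) /\ (m = (4 * j + 3)%nat -> r = 0)).
  { intros m. destruct (index_cases m) as [j [-> | [-> | ->]]];
      [exists (p j)|exists (- q j)|exists 0]; intros i; (split; [|split]); intros E;
      try (exfalso; lia); auto; f_equal; try f_equal; lia. }
  destruct (fun_choice _ _ _ F) as [w Hw]. clear F.
  assert (W1 : forall j, w (2 * j)%nat = p j) by (intros j; now apply (Hw _ j)).
  assert (W2 : forall j, w (4 * j + 1)%nat = - q j) by (intros j; now apply (Hw _ j)).
  assert (W3 : forall j, w (4 * j + 3)%nat = 0) by (intros j; now apply (Hw _ j)).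
  exists w. split; [|split; [|split]]; auto.
  - replace (fun j => w (2 * j)%nat) with p; auto. extensionality j. now rewrite W1.
  - replace (fun j => - w (4 * j + 1)%nat) with q; auto. extensionality j. rewrite W2. lra.
  (* The sign of [v i] selects the residue class of the slot and the rank selects the place in it; a
     null term has no rank and uses its own index instead. *)
  - set (c := fun i => match total_order_T (v i) 0 with
                       | inleft (left _) => (4 * sigma i + 1)%nat
                       | inleft (right _) => (4 * i + 3)%nat
                       | inright _ => (2 * rho i)%nat end).
    exists c. split; [|split; [|split]].
    + intros i j. unfold c.
      destruct (total_order_T (v i) 0) as [[A|A]|A], (total_order_T (v j) 0) as [[B|B]|B];
        intros E; try (exfalso; lia).
      * apply Q2; try lra. lia.
      * lia.
      * apply P2; try lra. lia.
    + intros i. unfold c. destruct (total_order_T (v i) 0) as [[A|A]|A].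
      * rewrite W2, Q1; lra.
      * now rewrite W3.
      * rewrite W1, P1; lra.
    + intros m Hm. destruct (index_cases m) as [j [-> | [-> | ->]]]; auto.
      * rewrite W1. destruct Dp as [D _]. destruct (D j) as [L|L]; auto.
        destruct (P3 j L) as (i & A & <-). exfalso. apply (Hm i). unfold c.
        destruct (total_order_T (v i) 0) as [[B|B]|B]; try lra. reflexivity.
      * rewrite W2. destruct Dq as [D _]. destruct (D j) as [L|L]; [|lra].
        destruct (Q3 j L) as (i & A & <-). exfalso. apply (Hm i). unfold c.
        destruct (total_order_T (v i) 0) as [[B|B]|B]; try lra. reflexivity.
    + intros i E. unfold c. destruct (total_order_T (v i) 0) as [[A|A]|A]; try lra. reflexivity.
Qed.

(** * Cutting the circle open at a point *)

(** The margin [eta] on each side of the cut ensures that an arc of length at most 2 eta between two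
    members does not cross it, see [cut_dist]. *)
Definition cut_at (alpha eta : R) (S : rigged Tcirc) :=
  forall z, S z <> Some 0%nat -> exists u, expi u = z /\ alpha - 2 * PI + eta < u < alpha - eta.

Lemma PI_gt_3 : 3 < PI.
Proof. pose proof PI2_3_2. lra. Qed.

(** Each point of the list costs one half of the current interval. *)
Lemma interval_avoiding (l : list R) :
  exists c d, 1 <= c /\ c < d /\ d <= 2 /\ forall x, In x l -> x <= c \/ d <= x.
Proof.
  induction l as [|a l (c & d & H1 & H2 & H3 & H)].
  - exists 1, 2. split; [lra|]. split; [lra|]. split; [lra|]. intros x [].
  - destruct (Rle_lt_dec a ((c + d) / 2)) as [A|A].
    + exists ((c + d) / 2), d. split; [lra|]. split; [lra|]. split; [lra|].
      intros x [<-|Hx]; [lra|]. destruct (H x Hx); lra.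
    + exists c, ((c + d) / 2). split; [lra|]. split; [lra|]. split; [lra|].
      intros x [<-|Hx]; [lra|]. destruct (H x Hx); lra.
Qed.

(* Only finitely many points of [S] are at distance [>= 1] from the base point, so some [alpha] in [(1, 2)] stays away from [S]. *)
Lemma cut_exists (S : rigged Tcirc) :
  S_one Tcirc distT T_one S ->
  exists alpha eta, 0 < eta /\ 1 <= alpha - eta /\ alpha <= 2 /\
    forall S', Rbar_lt (rdist Tcirc distT S' S) eta -> cut_at alpha eta S'.
Proof.
  intros HS. pose proof PI_gt_3 as HP.
  destruct (S_one_enum distT distT_nonneg _ _ HS) as (s & M & Hs & HM).
  assert (F : forall i, exists th, expi th = s i /\ Rabs th = distT (s i) T_one /\ Rabs th <= PI).
  { intros i. destruct (distT_lift (s i) 0) as (u & A & B & C).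
    rewrite Rminus_0_r, expi_0 in *. now exists u. }
  destruct (fun_choice _ _ _ F) as [th Hth]. clear F.
  destruct (sum_le_vanish _ _ 1 HM Rlt_0_1) as [N HN].
  destruct (interval_avoiding (map th (seq 0 N))) as (c & d & H1 & H2 & H3 & Hcd).
  (* Members of [S] are at least 5 eta / 2 away from the midpoint; after a move of at most eta more
     than eta remains. A quarter instead of a fifth would lose strictness. *)
  exists ((c + d) / 2), ((d - c) / 5).
  split; [lra|]. split; [lra|]. split; [lra|].
  assert (G : forall i, exists u, expi u = s i /\ d - 2 * PI <= u <= c).
  { intros i. destruct (Hth i) as (E & D & B).
    assert (A : th i <= c \/ d <= th i).
    { destruct (Nat.lt_ge_cases i N) as [L|L].
      - apply Hcd. apply in_map, in_seq. lia.
      - left. specialize (HN i L). rewrite <- D in HN. pose proof (Rle_abs (th i)). lra. }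
    pose proof (Rle_abs (th i)). pose proof (Rle_abs (- th i)) as B'. rewrite Rabs_Ropp in B'.
    destruct A as [A|A].
    - exists (th i). split; auto. lra.
    (* Angles beyond the gap are lowered by one turn to come below the cut. *)
    - exists (th i + 2 * PI * IZR (-1)). rewrite expi_period. split; auto. lra. }
  intros S' HS'.
  destruct (rdist_lt_enum distT distT_nonneg _ _ _ HS') as (x & y & Hx & Hy & Hxy).
  intros z Hz. apply (enum_support _ _ _ Hx) in Hz. destruct Hz as [i <-].
  assert (Y : S (y i) <> Some 0%nat) by (apply (enum_support _ _ _ Hy); now exists i).
  apply (enum_support _ _ _ Hs) in Y. destruct Y as [k Hk].
  destruct (G k) as (v & Ev & Bv). rewrite Hk in Ev.
  destruct (distT_lift (x i) v) as (u & Eu & Du & _).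
  exists u. split; auto.
  rewrite Ev in Du. pose proof (sum_le_term _ _ i Hxy) as T. simpl in T. rewrite <- Du in T.
  pose proof (Rle_abs (u - v)). pose proof (Rle_abs (- (u - v))) as B'. rewrite Rabs_Ropp in B'.
  lra.
Qed.

Lemma cut_inj (alpha u v : R) :
  alpha - 2 * PI < u < alpha -> alpha - 2 * PI < v < alpha -> expi u = expi v -> u = v.
Proof. intros Hu Hv. apply expi_inj. apply Rabs_def1; lra. Qed.

(** The lift of [expi u] nearest to [v] lies within 2 eta of [v]; the two margins then leave less
    than a full turn between it and [u], so the two coincide. *)
Lemma cut_dist (alpha eta u v : R) :
  alpha - 2 * PI + eta < u < alpha - eta -> alpha - 2 * PI + eta < v < alpha - eta ->
  distT (expi u) (expi v) <= 2 * eta -> Rabs (u - v) = distT (expi u) (expi v).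
Proof.
  intros Hu Hv H. destruct (distT_lift (expi u) v) as (u' & E & D & _).
  rewrite <- D in *.
  pose proof (Rle_abs (u' - v)). pose proof (Rle_abs (- (u' - v))) as B'. rewrite Rabs_Ropp in B'.
  rewrite (expi_inj u' u); auto. apply Rabs_def1; lra.
Qed.

Lemma cut_lift (alpha eta : R) (S : rigged Tcirc) (s : nat -> Tcirc) :
  cut_at alpha eta S -> is_enum Tcirc S s ->
  exists u, forall i, expi (u i) = s i /\ alpha - 2 * PI + eta < u i < alpha - eta.
Proof.
  intros C Hs.
  apply (fun_choice _ _ (fun i r => expi r = s i /\ alpha - 2 * PI + eta < r < alpha - eta)).
  intros i. apply C, (enum_support _ _ _ Hs). now exists i.
Qed.

(** Lifts in the cut interval satisfy |u| <= 8 d(e^(iu), 1): the interval contains [-1, 1], so at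
    distance below 1 the nearest lift is [u] itself; otherwise |u| < 8 because pi <= 4. *)
Lemma cut_enum (alpha eta : R) (S : rigged Tcirc) :
  0 < eta -> 1 <= alpha - eta -> alpha <= 2 -> cut_at alpha eta S -> S_one Tcirc distT T_one S ->
  exists (u : nat -> R) (M : R), is_enum Tcirc S (fun i => expi (u i)) /\
    (forall i, alpha - 2 * PI + eta < u i < alpha - eta) /\ sum_le (fun i => Rabs (u i)) M.
Proof.
  intros He H1 H2 C HS. pose proof PI_gt_3 as HP. pose proof PI_4 as HP4.
  destruct (S_one_enum distT distT_nonneg _ _ HS) as (s & M & Hs & HM).
  destruct (cut_lift _ _ _ _ C Hs) as [u Hu].
  exists u, (8 * M). split; [|split].
  - replace (fun i => expi (u i)) with s; auto. extensionality i. symmetry. apply Hu.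
  - intros i. apply Hu.
  - intros l ND. apply Rle_trans with (lsum (fun i => 8 * distT (s i) T_one) l).
    + apply lsum_le. intros i _. destruct (Hu i) as [E B].
      destruct (distT_lift (s i) 0) as (v & Ev & Dv & _).
      rewrite Rminus_0_r, expi_0 in Dv. rewrite <- Dv.
      destruct (Rlt_le_dec (Rabs v) 1) as [L|L].
      * apply Rabs_def2 in L as L'. assert (u i = v) as ->.
        { apply (cut_inj alpha); try lra. congruence. }
        pose proof (Rabs_pos v). lra.
      * apply Rle_trans with 8; [|lra]. apply Rabs_le. lra.
    + specialize (HM l ND). clear - HM.
      replace (lsum (fun i => 8 * distT (s i) T_one) l) with (8 * lsum (fun i => distT (s i) T_one) l);
        [lra|]. clear HM. induction l as [|i l IH]; simpl; [lra|]. rewrite <- IH. lra.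
Qed.

(** The enumerations that witness the distance are unrelated to [u] and [u']; composing embeddings
    through them gives an injection in each direction, the form that [sorted_copy_lip] takes. *)
Lemma cut_match (alpha eta eps : R) (S S' : rigged Tcirc) (u u' : nat -> R) :
  eps <= 2 * eta ->
  is_enum Tcirc S (fun i => expi (u i)) -> is_enum Tcirc S' (fun i => expi (u' i)) ->
  (forall i, alpha - 2 * PI + eta < u i < alpha - eta) ->
  (forall i, alpha - 2 * PI + eta < u' i < alpha - eta) ->
  Rbar_lt (rdist Tcirc distT S' S) eps ->
  exists f g, Injective f /\ Injective g /\
    sum_le (fun i => Rabs (u' i - u (f i))) eps /\ sum_le (fun i => Rabs (u' (g i) - u i)) eps.
Proof.
  intros He Hu Hu' Bu Bu' H.
  destruct (rdist_lt_enum distT distT_nonneg _ _ _ H) as (s & t & Hs & Ht & Hst).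
  destruct (enum_embed _ _ _ Hu' Hs) as (f1 & I1 & F1).
  destruct (enum_embed _ _ _ Ht Hu) as (f2 & I2 & F2).
  destruct (enum_embed _ _ _ Hu Ht) as (g1 & J1 & G1).
  destruct (enum_embed _ _ _ Hs Hu') as (g2 & J2 & G2).
  assert (T : forall i, distT (s i) (t i) <= 2 * eta).
  { intros i. pose proof (sum_le_term _ _ i Hst) as Q. simpl in Q. lra. }
  exists (fun i => f2 (f1 i)), (fun i => g2 (g1 i)). split; [|split; [|split]].
  - intros i j E. apply I1, I2, E.
  - intros i j E. apply J1, J2, E.
  - replace (fun i => Rabs (u' i - u (f2 (f1 i)))) with (fun i => distT (s (f1 i)) (t (f1 i))).
    + exact (sum_le_inj (fun i => distT (s i) (t i)) f1 eps I1 Hst).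
    + extensionality i. rewrite F1, <- F2. symmetry. apply (cut_dist alpha eta); auto.
      rewrite F2, <- F1. apply T.
  - replace (fun i => Rabs (u' (g2 (g1 i)) - u i)) with (fun i => distT (s (g1 i)) (t (g1 i))).
    + exact (sum_le_inj (fun i => distT (s i) (t i)) g1 eps J1 Hst).
    + extensionality i. rewrite G1, <- G2. symmetry. apply (cut_dist alpha eta); auto.
      rewrite G2, <- G1. apply T.
Qed.

(** * Lifting paths *)

Definition lift_on (J : R -> Prop) (P : R -> rigged Tcirc) (Q : R -> rigged R) :=
  (forall t, J t -> S_one R distR 0 (Q t) /\ pushforward (Q t) (P t)) /\
  forall t, J t -> forall eps, 0 < eps -> exists delta, 0 < delta /\
    forall t', J t' -> Rabs (t' - t) < delta -> Rbar_lt (rdist R distR (Q t') (Q t)) eps.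

Lemma expi_shift (a b c : R) : expi a = expi b -> expi (a + c - b) = expi c.
Proof.
  intros E. apply expi_eq in E. destruct E as [k ->].
  rewrite <- (expi_period c k). f_equal. ring.
Qed.

Lemma sum_le_null (v : nat -> R) (M : R) : sum_le (fun i => Rabs (v i)) M -> null_seq v.
Proof. intros H eps He. apply (sum_le_vanish _ _ eps H He). Qed.

Lemma sorted_copy_sum (v w : nat -> R) (M : R) :
  sorted_copy v w -> (sum_le (fun i => Rabs (v i)) M <-> sum_le (fun m => Rabs (w m)) M).
Proof.
  intros (_ & _ & _ & c & Ic & Hc & H0 & _).
  assert (E : (fun i => Rabs (v i)) = (fun i => Rabs (w (c i)))).
  { extensionality i. now rewrite Hc. }
  rewrite E. split.
  - intros H. apply (sum_le_pull _ c); auto. intros m.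
    destruct (classic (exists i, c i = m)) as [|C]; auto.
    left. rewrite H0, Rabs_R0; [lra|]. intros i Hi. apply C. now exists i.
  - intros H. exact (sum_le_inj (fun m => Rabs (w m)) c M Ic H).
Qed.

(* While [P] avoids the cut, the sorted copies [w t] of its points are [l^1]-continuous in [t].  The lift starts from the enumeration [r] of [Qa] matched with [w a] and lets each point move parallel to the corresponding point of [w]. *)
Lemma local_lift (alpha eta a : R) (J : R -> Prop) (P : R -> rigged Tcirc) (Qa : rigged R) :
  0 < eta -> 1 <= alpha - eta -> alpha <= 2 -> J a ->
  (forall t, J t -> S_one Tcirc distT T_one (P t)) ->
  (forall t, J t -> cut_at alpha eta (P t)) ->
  (forall t, J t -> forall eps, 0 < eps -> exists delta, 0 < delta /\
     forall t', J t' -> Rabs (t' - t) < delta -> Rbar_lt (rdist Tcirc distT (P t') (P t)) eps) ->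
  S_one R distR 0 Qa -> pushforward Qa (P a) ->
  exists Q, Q a = Qa /\ lift_on J P Q.
Proof.
  intros He H1 H2 Ja PS PC PJ HQ Hp. pose proof PI_gt_3 as HP.
  assert (F : forall t, exists uw : (nat -> R) * (nat -> R), J t ->
    let (u, w) := uw in exists M : R,
      is_enum Tcirc (P t) (fun i => expi (u i)) /\
      (forall i, alpha - 2 * PI + eta < u i < alpha - eta) /\
      sum_le (fun i => Rabs (u i)) M /\ sorted_copy u w).
  { intros t. destruct (classic (J t)) as [Jt|Nt].
    - destruct (cut_enum alpha eta (P t)) as (u & M & A & B & C); auto.
      destruct (sorted_copy_exists u) as [w Hw]; [now apply sum_le_null with M|].
      exists (u, w). intros _. exists M. auto.
    - exists (fun _ => 0, fun _ => 0). contradiction. }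
  destruct (fun_choice _ _ _ F) as [uw Huw]. clear F.
  assert (E : exists u w : R -> nat -> R, forall t, J t -> exists M : R,
      is_enum Tcirc (P t) (fun i => expi (u t i)) /\
      (forall i, alpha - 2 * PI + eta < u t i < alpha - eta) /\
      sum_le (fun i => Rabs (u t i)) M /\ sorted_copy (u t) (w t)).
  { exists (fun t => fst (uw t)), (fun t => snd (uw t)). intros t Jt. specialize (Huw t Jt).
    now destruct (uw t). }
  clear uw Huw. destruct E as (u & w & Huw).
  destruct (S_one_enum distR distR_nonneg _ _ HQ) as (q & Mq & Hq & Sq).
  assert (Sq' : sum_le (fun i => Rabs (q i)) Mq).
  { revert Sq. apply sum_le_mono. intros i. unfold distR. rewrite Rminus_0_r. lra. }
  pose proof (enum_of_push _ _ _ Hq Hp) as Hqe.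
  (* [v i] is the representative of [q i] modulo 2 pi in the cut interval, under the same index. *)
  destruct (cut_lift _ _ _ _ (PC a Ja) Hqe) as [v Hv].
  assert (Hve : is_enum Tcirc (P a) (fun i => expi (v i))).
  { replace (fun i => expi (v i)) with (fun i => expi (q i)); auto.
    extensionality i. symmetry. apply Hv. }
  destruct (Huw a Ja) as (Ma & Ea & Ba & Sa & Wa).
  destruct (enum_embed _ _ _ Hve Ea) as (f & If & Hf).
  destruct (enum_embed _ _ _ Ea Hve) as (g & Ig & Hg).
  assert (Hf' : forall i, u a (f i) = v i).
  { intros i. specialize (Hf i). specialize (Ba (f i)). destruct (Hv i) as [_ Bi].
    apply (cut_inj alpha); auto; lra. }
  assert (Hg' : forall i, v (g i) = u a i).
  { intros i. specialize (Hg i). specialize (Ba i). destruct (Hv (g i)) as [_ Bi].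
    apply (cut_inj alpha); auto; lra. }
  assert (Sv : sum_le (fun i => Rabs (v i)) Ma).
  { replace (fun i => Rabs (v i)) with (fun i => Rabs (u a (f i))).
    - exact (sum_le_inj (fun i => Rabs (u a i)) f Ma If Sa).
    - extensionality i. now rewrite Hf'. }
  destruct (sorted_copy_exists v (sum_le_null _ _ Sv)) as [w' Wv].
  (* [v] and [u a] list the same points of the interval, so [sorted_copy_lip] with delta = 0
     identifies their sorted copies. The slots [c] of [v] thereby become slots of [w a]. *)
  assert (Ew : w' = w a).
  { extensionality m.
    pose proof (sorted_copy_lip _ _ _ _ f g 0 Wv Wa If Ig) as L.
    enough (Rabs (w' m - w a m) <= 0) as A.
    { pose proof (Rle_abs (w' m - w a m)). pose proof (Rle_abs (- (w' m - w a m))) as B.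
      rewrite Rabs_Ropp in B. lra. }
    apply L; intros i; [rewrite Hf'|rewrite Hg']; rewrite Rminus_diag, Rabs_R0; lra. }
  subst w'.
  destruct Wv as (_ & _ & Wz & c & Ic & Hc & Hc0 & Hc3).
  (* [r] puts [q i] into the slot of [v i]; empty slots receive 0, which has infinite multiplicity
     in [Qa]. *)
  assert (Rex : forall m, exists r, (forall i, c i = m -> r = q i) /\ ((forall i, c i <> m) -> r = 0)).
  { intros m. destruct (classic (exists i, c i = m)) as [[i <-]|C].
    - exists (q i). split; [intros j Hj; now rewrite (Ic _ _ Hj)|]. intros D. now destruct (D i).
    - exists 0. split; auto. intros i Hi. exfalso. apply C. now exists i. }
  destruct (fun_choice _ _ _ Rex) as [r Hr]. clear Rex.
  assert (Hrc : forall i, r (c i) = q i) by (intros i; now apply (Hr (c i))).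
  assert (Hr0 : forall m, (forall i, c i <> m) -> r m = 0) by (intros m; apply Hr).
  assert (Er : is_enum R Qa r).
  { apply (enum_reindex Qa 0 q r c); auto. now apply (S_one_base distR). }
  assert (Sr : sum_le (fun m => Rabs (r m)) Mq).
  { apply (sum_le_pull _ c).
    - intros m. destruct (classic (exists i, c i = m)) as [|C]; auto.
      left. rewrite Hr0, Rabs_R0; [lra|]. intros i Hi. apply C. now exists i.
    - revert Sq'. apply sum_le_mono. intros i. rewrite Hrc. lra. }
  assert (Erw : forall m, expi (r m) = expi (w a m)).
  { intros m. destruct (classic (exists i, c i = m)) as [[i <-]|C].
    - rewrite Hrc, Hc. symmetry. apply Hv.
    - rewrite Hr0, Hc0; auto; intros i Hi; apply C; now exists i. }
  set (x := fun t m => r m + w t m - w a m).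
  assert (Ewt : forall t, J t -> is_enum Tcirc (P t) (fun m => expi (x t m))).
  { intros t Jt. destruct (Huw t Jt) as (Mt & Et & Bt & St & Wt).
    replace (fun m => expi (x t m)) with (fun m => expi (w t m)).
    - destruct Wt as (_ & _ & _ & d & Id & Hd & Hd0 & _).
      apply (enum_reindex (P t) T_one (fun i => expi (u t i)) _ d); auto.
      + apply (S_one_base distT). auto.
      + intros i. now rewrite Hd.
      + intros m Hm. now rewrite Hd0, expi_0.
    - extensionality m. symmetry. apply expi_shift, Erw. }
  (* The condition at [a] is built into the choice so that [Q a] is [Qa] itself. *)
  assert (Qex : forall t, exists Qt, is_enum R Qt (x t) /\ (t = a -> Qt = Qa)).
  { intros t. destruct (Req_dec t a) as [->|N].
    - exists Qa. split; auto. replace (x a) with r; auto.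
      extensionality m. unfold x. lra.
    - destruct (enum_exists (x t)) as [Qt HQt]. exists Qt. split; auto. contradiction. }
  destruct (fun_choice _ _ _ Qex) as [Q HQt]. clear Qex.
  exists Q. split; [now apply HQt|]. split.
  - intros t Jt. split.
    + destruct (Huw t Jt) as (Mt & Et & Bt & St & Wt).
      apply (S_one_of_enum (Q t) (x t) (Mq + (Mt + Ma))); [apply HQt| |].
      * apply sum_le_mono with (fun m => Rabs (r m) + (Rabs (w t m) + Rabs (w a m))).
        { intros m. unfold x. pose proof (Rabs_triang (r m + w t m) (- w a m)) as A.
          pose proof (Rabs_triang (r m) (w t m)) as B. rewrite Rabs_Ropp in A. unfold Rminus. lra. }
        apply sum_le_plus; auto. apply sum_le_plus; [now apply (sorted_copy_sum (u t))|].
        now apply (sorted_copy_sum (u a)).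
      (* Infinitely many [q i] vanish. Their slots 4 i + 3 are null in every [w t], so these members
         stay at 0 for all times and 0 keeps infinite multiplicity. *)
      * apply (S_one_base distR) in HQ. apply (enum_infinite _ _ _ Hq) in HQ.
        intros N. destruct (HQ N) as (i & Hi & Ei). exists (4 * i + 3)%nat. split; [lia|].
        assert (Vi : v i = 0).
        { destruct (Hv i) as [A B]. apply (cut_inj alpha); try lra. now rewrite A, Ei. }
        unfold x. rewrite Wz. destruct Wt as (_ & _ & -> & _).
        rewrite <- (Hc3 i Vi), Hrc, Ei. ring.
    + apply push_of_enum with (x t); [apply HQt|auto].
  - intros t Jt eps Heps.
    destruct (Huw t Jt) as (Mt & Et & Bt & St & Wt).
    destruct (sum_le_scheffe (w t) Mt (eps / 2)) as (d & Hd & Hs).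
    { now apply (sorted_copy_sum (u t)). }
    { lra. }
    (* The bound 2 eta keeps matched pairs on one side of the cut; the bound [d] is the closeness
       asked for by [sum_le_scheffe]. *)
    destruct (PJ t Jt (Rmin d (2 * eta))) as (delta & Hdelta & Hnear).
    { apply Rmin_pos; lra. }
    exists delta. split; auto. intros t' Jt' Dt'.
    destruct (Huw t' Jt') as (Mt' & Et' & Bt' & St' & Wt').
    destruct (cut_match alpha eta (Rmin d (2 * eta)) (P t) (P t') (u t) (u t'))
      as (f' & g' & If' & Ig' & Sf & Sg); auto.
    { apply Rmin_r. }
    pose proof (Rmin_l d (2 * eta)) as Ld.
    assert (Sx : sum_le (fun m => Rabs (w t' m - w t m)) (eps / 2)).
    { apply Hs.
      - intros m. apply Rle_trans with (Rmin d (2 * eta)); auto.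
        apply (sorted_copy_lip (u t') (u t) _ _ f' g'); auto; intros i.
        + exact (sum_le_term _ _ i Sf).
        + exact (sum_le_term _ _ i Sg).
      (* The total is compared on the unsorted families, where the matching [f'] gives the triangle
         inequality term by term. *)
      - intros K HK. apply (sorted_copy_sum (u t')); auto. apply (sorted_copy_sum (u t)) in HK; auto.
        apply sum_le_mono with (fun i => Rabs (u t (f' i)) + Rabs (u t' i - u t (f' i))).
        + intros i. pose proof (Rabs_triang_inv (u t' i) (u t (f' i))). lra.
        + apply sum_le_plus.
          * exact (sum_le_inj (fun i => Rabs (u t i)) f' K If' HK).
          * intros l ND. specialize (Sf l ND). lra. }
    apply Rbar_le_lt_trans with (eps / 2); [|simpl; lra].
    apply (rdist_le_enum distR distR_nonneg _ _ (x t') (x t)); [apply HQt|apply HQt|].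
    revert Sx. apply sum_le_mono. intros m. unfold distR, x.
    right. f_equal. ring.
Qed.

(** Quantifying over all initial lifts lets the end value on one interval serve as the initial value
    on the next. *)
Definition liftable (P : R -> rigged Tcirc) (a b : R) :=
  forall Qa, S_one R distR 0 Qa -> pushforward Qa (P a) ->
    exists Q, Q a = Qa /\ lift_on (fun t => a <= t <= b) P Q.

Lemma liftable_trans (P : R -> rigged Tcirc) (a b c : R) :
  a <= b -> b <= c -> liftable P a b -> liftable P b c -> liftable P a c.
Proof.
  intros Hab Hbc H1 H2 Qa HQ Hp.
  destruct (H1 Qa HQ Hp) as (Q1 & E1 & V1 & C1).
  destruct (V1 b) as [S1 Pb]; [lra|].
  destruct (H2 (Q1 b) S1 Pb) as (Q2 & E2 & V2 & C2).
  exists (fun t => if Rle_dec t b then Q1 t else Q2 t). split; [|split].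
  - destruct (Rle_dec a b); [auto|lra].
  - intros t Ht. destruct (Rle_dec t b); [apply V1|apply V2]; lra.
  - intros t Ht eps Heps. destruct (Rtotal_order t b) as [L|[->|L]].
    + destruct (C1 t ltac:(lra) eps Heps) as (d & Hd & H).
      exists (Rmin d (b - t)). split; [apply Rmin_pos; lra|].
      intros t' Ht' D. pose proof (Rmin_l d (b - t)). pose proof (Rmin_r d (b - t)).
      pose proof (Rle_abs (t' - t)).
      destruct (Rle_dec t b), (Rle_dec t' b); try lra. apply H; lra.
    + destruct (C1 b ltac:(lra) eps Heps) as (d1 & Hd1 & H1').
      destruct (C2 b ltac:(lra) eps Heps) as (d2 & Hd2 & H2').
      exists (Rmin d1 d2). split; [now apply Rmin_pos|].
      intros t' Ht' D. pose proof (Rmin_l d1 d2). pose proof (Rmin_r d1 d2).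
      destruct (Rle_dec b b) as [_|]; [|lra]. destruct (Rle_dec t' b).
      * apply H1'; lra.
      * rewrite <- E2. apply H2'; lra.
    + destruct (C2 t ltac:(lra) eps Heps) as (d & Hd & H).
      exists (Rmin d (t - b)). split; [apply Rmin_pos; lra|].
      intros t' Ht' D. pose proof (Rmin_l d (t - b)). pose proof (Rmin_r d (t - b)).
      pose proof (Rle_abs (- (t' - t))) as B. rewrite Rabs_Ropp in B.
      destruct (Rle_dec t b), (Rle_dec t' b); try lra. apply H; lra.
Qed.

(** Throughout the window [P t] stays within [eta] of [P t0], so the cut found for [P t0] serves all
    its subintervals. *)
Lemma liftable_locally (P : R -> rigged Tcirc) (t0 : R) :
  cont_path Tcirc distT T_one P -> 0 <= t0 <= 1 ->
  exists delta, 0 < delta /\ forall a b, 0 <= a -> a <= b -> b <= 1 ->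
    t0 - delta < a -> b < t0 + delta -> liftable P a b.
Proof.
  intros [PS PJ] Ht0.
  destruct (cut_exists (P t0) (PS t0 Ht0)) as (alpha & eta & He & H1 & H2 & Hcut).
  destruct (PJ t0 Ht0 eta He) as (delta & Hd & H).
  exists delta. split; auto. intros a b Ha Hab Hb La Lb Qa HQ Hp.
  apply (local_lift alpha eta); auto; try lra.
  - intros t Ht. apply PS. lra.
  - intros t Ht. apply Hcut, H; [lra|]. apply Rabs_def1; lra.
  - intros t Ht eps Heps. destruct (PJ t ltac:(lra) eps Heps) as (d & Hd' & H').
    exists d. split; auto. intros t' Ht' D. apply H'; auto. lra.
Qed.

Lemma liftable_0_1 (P : R -> rigged Tcirc) :
  cont_path Tcirc distT T_one P -> liftable P 0 1.
Proof.
  intros HP.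
  set (E := fun b => 0 <= b <= 1 /\ liftable P 0 b).
  assert (E0 : E 0).
  { split; [lra|]. destruct (liftable_locally P 0 HP) as (d & Hd & H); [lra|]. apply H; lra. }
  destruct (completeness E) as [s [UB LB]].
  - exists 1. intros b [Hb _]. lra.
  - now exists 0.
  - assert (Hs : 0 <= s <= 1).
    { split; [now apply UB|]. apply LB. intros b [Hb _]. lra. }
    destruct (liftable_locally P s HP Hs) as (d & Hd & H).
    assert (exists b, E b /\ s - d < b) as (b & [Hb Lb] & Hbs).
    { apply NNPP. intros C. enough (s <= s - d) by lra. apply LB. intros b Eb.
      apply Rnot_lt_le. intros L. apply C. now exists b. }
    assert (b <= s) by (apply UB; now split).
    (* [b] and [c] both lie in the window around [s], so [c] is reached; as [c <= s] excludes s + d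
       / 2, it must be 1. *)
    set (c := Rmin 1 (s + d / 2)).
    assert (C1 : c <= 1) by apply Rmin_l.
    assert (C2 : c <= s + d / 2) by apply Rmin_r.
    assert (C3 : s <= c) by (apply Rmin_glb; lra).
    assert (Lc : liftable P 0 c).
    { apply liftable_trans with b; try lra; auto. apply H; lra. }
    assert (c <= s) by (apply UB; split; auto; lra).
    assert (c = 1) as <-; auto.
    unfold c, Rmin in *. destruct (Rle_dec 1 (s + d / 2)); lra.
Qed.

Theorem mainTheorem5 :
  forall (S0 : rigged R) (P : R -> rigged Tcirc),
    S_one R distR 0 S0 ->
    cont_path Tcirc distT T_one P ->
    pushforward S0 (P 0) ->
    exists Q : R -> rigged R,
      cont_path R distR 0 Q /\ Q 0 = S0 /\
      (forall t, 0 <= t <= 1 -> pushforward (Q t) (P t)).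
Proof.
  intros S0 P HS HP Hp.
  destruct (liftable_0_1 P HP S0 HS Hp) as (Q & E & V & C).
  exists Q. split; [split|split]; auto; intros t Ht; now apply V.
Qed.
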